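(* Fix a filtration $\{Q(C;\alpha)\}$ of simplicial complexes on a finite cloud $C$ in a metric space. For every $\alpha>0$, the reduced skeleton $\mathrm{HoPeS}(C;\alpha)$ has the minimum total length of edges over all graphs $G\subseteq Q(C;\alpha)$ that span $Q(C;\alpha)$ and for which the inclusion induces an isomorphism $H_1(G;\mathbb{Z}_2)\to H_1(Q(C;\alpha);\mathbb{Z}_2)$ (and $\mathrm{HoPeS}(C;\alpha)$ itself is such a graph).
   Context: A filtration on a finite set $C$: nested finite simplicial complexes $Q(C;\alpha)$, $\alpha\ge0$, with vertex set $C$, $Q(C;0)=C$, each simplex entering at a minimal scale; final complex connected. Edge length $|e|=2\min\{\alpha:e\subset Q(C;\alpha)\}$. $\mathrm{MST}(C)$ is a minimum total length spanning tree on $C$ using filtration edges; $\mathrm{MST}(C;\alpha)$ removes all open edges of length $>2\alpha$. A graph $G$ spans a complex $Q$ on $C$ if $G$ has vertex set $C$, every edge of $G$ is in $Q$, and the inclusion induces a bijection on connected components. Homology with $\mathbb{Z}_2$ coefficients. An edge is critical if its addition creates a new class in $H_1$ that does not immediately die; its birth is its entry scale. Deaths of critical edges: at scale $\alpha$, let $K_1,\dots,K_s$ be the critical edges with birth $\le\alpha$ not yet assigned a death; $[K_1],\dots,[K_s]$ form a basis of $H_1((\mathrm{MST}(C;\alpha)\cup\bigcup K_j)/\mathrm{MST}(C;\alpha))$; let $f$ be the map into $H_1(Q(C;\alpha)/\mathrm{MST}(C;\alpha))$ induced by inclusion; take a basis $b_1,\dots,b_r$ of $\ker f$, $b_i=\sum_jc_{ij}[K_j]$,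 and solve $\sum_jc_{ij}x_j=0$ over $\mathbb{Z}_2$ with $r$ leading variables chosen by the elder rule (the leading set whose critical edges have greatest combined birth; any choice among ties); each $K_i$ with $i$ leading gets death $\alpha$. $\mathrm{HoPeS}(C)$ is the union of $\mathrm{MST}(C)$ and all critical edges labelled by (birth, death). The reduced skeleton $\mathrm{HoPeS}(C;\alpha)$ is obtained from $\mathrm{HoPeS}(C)$ by removing all edges of length $>2\alpha$ and all critical edges with death $\le\alpha$. *)

(* Defs.v *)
(* Z/2 simplicial chains are encoded as finite sets of simplices. *)
From HB Require Import structures.
From mathcomp Require Import all_boot all_order all_algebra.
Set Implicit Arguments. Unset Strict Implicit. Unset Printing Implicit Defensive.
Import Order.TTheory GRing.Theory Num.Theory.
Local Open Scope ring_scope.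

Section HoPeS.
Variables (T : finType) (R : realFieldType).

(* simplices are nonempty finite subsets of the cloud T; complexes are sets of simplices *)
Definition is_edge (e : {set T}) := #|e| == 2%N.
Definition is_tri (t : {set T}) := #|t| == 3%N.
Definition edges (X : {set {set T}}) := [set e in X | is_edge e].
Definition tris (X : {set {set T}}) := [set t in X | is_tri t].

(* sum of Z/2-chains = symmetric difference *)
Definition symd (A B : {set {set T}}) := (A :\: B) :|: (B :\: A).

(* Z/2 boundary of a 1-chain (a set of edges) and of a 2-chain (a set of triangles) *)
Definition bd1 (c : {set {set T}}) : {set T} :=
  [set v | odd #|[set e in c | v \in e]|].
Definition bd2 (S : {set {set T}}) : {set {set T}} :=
  [set e | is_edge e && odd #|[set t in S | e \subset t]|].

Definition bdry (X : {set {set T}}) (c : {set {set T}}) : bool :=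
  [exists S : {set {set T}}, (S \subset tris X) && (c == bd2 S)].

Definition adjrel (E : {set {set T}}) : rel T := fun u v => [set u; v] \in E.

(* Filtration: the simplex s of the final complex K enters at scale ent s;
   Q(C;alpha) = [set s in K | ent s <= alpha]. *)
Record filtration (K : {set {set T}}) (ent : {set T} -> R) : Prop := {
  filt_nonempty : forall s, s \in K -> s != set0;
  filt_closed : forall s t, s \in K -> t != set0 -> t \subset s ->
                  t \in K /\ ent t <= ent s;
  filt_vert : forall v, [set v] \in K /\ ent [set v] = 0;
  filt_zero : forall s, s \in K -> (1 < #|s|)%N -> 0 < ent s;   (* Q(C;0) = C *)
  filt_conn : forall u v, connect (adjrel K) u v }.

Definition Q (K : {set {set T}}) (ent : {set T} -> R) (alpha : R) :=
  [set s in K | ent s <= alpha].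

(* total length, with |e| = 2 * entry scale *)
Definition len (ent : {set T} -> R) (E : {set {set T}}) : R :=
  \sum_(e in E) 2 * ent e.

(* The graph (C, E) spans the complex X: edges in X, and inclusion induces
   a bijection on connected components (both have vertex set C). *)
Definition spans (E X : {set {set T}}) : Prop :=
  E \subset edges X /\
  forall u v, connect (adjrel (edges X)) u v -> connect (adjrel E) u v.

Definition H1iso (E X : {set {set T}}) : Prop :=
  (forall z : {set {set T}}, z \subset E -> bd1 z = set0 -> bdry X z -> z = set0) /\
  (forall z : {set {set T}}, z \subset edges X -> bd1 z = set0 ->
     exists2 w : {set {set T}}, w \subset E /\ bd1 w = set0 & bdry X (symd z w)).

Definition spanning_tree (K E : {set {set T}}) : Prop :=
  spans E K /\ (forall c : {set {set T}}, c \subset E -> bd1 c = set0 -> c = set0).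

Definition is_MST (K : {set {set T}}) (ent : {set T} -> R) (E : {set {set T}}) :=
  spanning_tree K E /\ forall E' : {set {set T}}, spanning_tree K E' -> len ent E <= len ent E'.

Definition mst_at (ent : {set T} -> R) (mst : {set {set T}}) (alpha : R) :=
  [set e in mst | 2 * ent e <= 2 * alpha].

Definition compatible_order (K : {set {set T}}) (ent : {set T} -> R)
    (mst : {set {set T}}) (rk : {set T} -> nat) : Prop :=
  [/\ {in K &, injective rk},
      (forall s t, s \in K -> t \in K -> ent s < ent t -> (rk s < rk t)%N),
      (forall s t, s \in K -> t \in K -> t \proper s -> (rk t < rk s)%N) &
      (forall e f, e \in mst -> f \in edges K -> f \notin mst -> ent e = ent f ->
         (rk e < rk f)%N)].

Definition before (K : {set {set T}}) (rk : {set T} -> nat) (e : {set T}) :=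
  [set s in K | (rk s < rk e)%N].

(* e is critical: adding e to the complex of the preceding simplices creates a
   cycle z (a new class of H_1) that does not die in Q(C; ent e), i.e. z is not
   in Z_1(before) + B_1(Q(C;ent e)). *)
Definition critical (K : {set {set T}}) (ent : {set T} -> R) (rk : {set T} -> nat)
    (e : {set T}) : bool :=
  (e \in edges K) &&
  [exists z : {set {set T}},
    [&& z \subset edges (before K rk e) :|: [set e], e \in z, bd1 z == set0 &
     ~~ [exists w : {set {set T}},
          [&& w \subset edges (before K rk e), bd1 w == set0 &
              bdry (Q K ent (ent e)) (symd z w)]]]].

Section Deaths.
Variables (K : {set {set T}}) (ent : {set T} -> R) (mst : {set {set T}})
          (rk : {set T} -> nat) (death : {set T} -> option R).

Definition alive_set (alpha : R) : {set {set T}} :=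
  [set e | [&& critical K ent rk e, ent e <= alpha &
               if death e is Some d then alpha <= d else true]].

Definition dying_set (alpha : R) : {set {set T}} :=
  [set e | critical K ent rk e && (death e == Some alpha)].

(* J (a Z/2-combination of the K_j, j in S) lies in the kernel of
   f : H_1((MST(alpha) u U K_j)/MST(alpha)) -> H_1(Q(alpha)/MST(alpha)),
   computed as relative homology: J in C_1(MST(alpha)) + B_1(Q(alpha)). *)
Definition inKer (alpha : R) (S J : {set {set T}}) : bool :=
  (J \subset S) &&
  [exists M : {set {set T}}, exists Tr : {set {set T}},
     [&& M \subset mst_at ent mst alpha, Tr \subset tris (Q K ent alpha) &
         J == symd M (bd2 Tr)]].

(* x (a Z/2-vector indexed by S) solves the system sum_j c_ij x_j = 0 *)
Definition solves (alpha : R) (S x : {set {set T}}) : bool :=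
  [forall J : {set {set T}}, inKer alpha S J ==> ~~ odd #|J :&: x|].

(* L is a set of leading variables: every assignment of the free variables
   S \ L extends uniquely to a solution *)
Definition leading (alpha : R) (S L : {set {set T}}) : Prop :=
  L \subset S /\
  forall y : {set {set T}}, y \subset S :\: L ->
    exists! x : {set {set T}}, [/\ x \subset S, x :\: L = y & solves alpha S x].

(* the death labels follow the elder rule at every scale *)
Definition deaths_ok : Prop :=
  forall alpha : R,
    let S := alive_set alpha in
    let D := dying_set alpha in
    [/\ D \subset S, leading alpha S D &
        forall L : {set {set T}}, leading alpha S L ->
          \sum_(e in L) ent e <= \sum_(e in D) ent e].

Definition HoPeS (alpha : R) : {set {set T}} :=
  [set e | [&& (e \in mst) || critical K ent rk e, 2 * ent e <= 2 * alpha &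
     ~~ (critical K ent rk e && (if death e is Some d then d <= alpha else false))]].

End Deaths.
End HoPeS.

(* Main.v *)
(* A graph G satisfies the two homological conditions at scale alpha exactly when
   its edges form a basis of C_1(Q(alpha))/B_1(Q(alpha)), so the theorem says that
   HoPeS(alpha) is a minimum-weight basis of a linear matroid over Z/2.  Likewise
   the tree is a minimum-weight basis of C_1(K)/Z_1(K).  An edge which is neither in
   the tree nor critical is, modulo boundaries, a sum of earlier edges; since
   boundaries only grow with the scale, induction on the number of deaths before
   alpha shows that MST(alpha) and the critical edges still alive generate every
   edge from edges which are no longer.  A leading set is the complement, among the
   alive edges, of a basis modulo MST(alpha), so by the elder rule removing the
   dying edges leaves a basis which no exchange can improve. *)
Require Import Defs.
From HB Require Import structures.
From mathcomp Require Import all_boot all_order all_algebra.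
Import Order.TTheory GRing.Theory Num.Theory.
Local Open Scope ring_scope.

Set Implicit Arguments. Unset Strict Implicit. Unset Printing Implicit Defensive.

(** * Chains over Z/2, boundary operators and separating forms *)

Section Chains.
Variable T : finType.
Implicit Types (a b c A E G H X Y S : {set {set T}}) (e : {set T}).

Lemma in_symd a b e : (e \in symd a b) = (e \in a) (+) (e \in b).
Proof. by rewrite !inE; case: (e \in a); case: (e \in b). Qed.

Lemma symdC : commutative (@symd T).
Proof. by move=> a b; apply/setP=> e; rewrite !in_symd addbC. Qed.

Lemma symdA : associative (@symd T).
Proof. by move=> a b c; apply/setP=> e; rewrite !in_symd addbA. Qed.

Lemma symdv a : symd a a = set0.
Proof. by apply/setP=> e; rewrite in_symd addbb inE. Qed.

Lemma symd0 : right_id set0 (@symd T).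
Proof. by move=> a; apply/setP=> e; rewrite in_symd inE addbF. Qed.

Lemma sym0d : left_id set0 (@symd T).
Proof. by move=> a; rewrite symdC symd0. Qed.

Lemma symdK a b : symd a (symd a b) = b.
Proof. by rewrite symdA symdv sym0d. Qed.

Lemma symdACA a b c d : symd (symd a b) (symd c d) = symd (symd a c) (symd b d).
Proof. by apply/setP=> e; rewrite !in_symd addbACA. Qed.

Lemma symd_sub a b c : a \subset c -> b \subset c -> symd a b \subset c.
Proof.
move=> /subsetP ac /subsetP bc; apply/subsetP=> e; rewrite in_symd.
by have [/ac | _ /= /bc] := boolP (e \in a).
Qed.

(** Facts that are linear in a chain reduce to single simplices. Keeping [e \in c] in the step makes
    hypotheses on the members of [c] available there. *)
Lemma chain_ind (P : {set {set T}} -> Prop) c :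
  P set0 -> (forall e a, e \in c -> P a -> P (symd [set e] a)) -> P c.
Proof.
move=> P0 PS; have [n] := ubnP #|c|; elim: n c PS => // n IH c PS.
have [-> // | [e ec]] := set_0Vmem c; rewrite (cardsD1 e) ec ltnS => cn.
have -> : c = symd [set e] (c :\ e).
  by apply/setP=> f; rewrite in_symd !inE; case: eqP => // ->; rewrite ec.
apply: (PS) => //; apply: IH => // f a; rewrite inE => /andP[_ fc]; exact: PS.
Qed.

Lemma odd_card_symdiff (I : finType) (A B : {set I}) :
  odd #|(A :\: B) :|: (B :\: A)| = odd #|A| (+) odd #|B|.
Proof.
rewrite -(cardsID B A) -(cardsID A B) (setIC B A) cardsU.
have -> : (A :\: B) :&: (B :\: A) = set0.
  by apply/setP=> x; rewrite !inE; case: (x \in A); case: (x \in B).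
by rewrite cards0 subn0 !oddD; case: (odd _); case: (odd _); case: (odd _).
Qed.

Lemma odd_cardI_symd a b c : 
  odd #|symd a b :&: c| = odd #|a :&: c| (+) odd #|b :&: c|.
Proof.
rewrite -odd_card_symdiff; congr (odd #|pred_of_set _|).
by apply/setP=> e; rewrite !inE; case: (e \in a); case: (e \in b); case: (e \in c).
Qed.

Lemma in_bd1_symd a b v : (v \in bd1 (symd a b)) = (v \in bd1 a) (+) (v \in bd1 b).
Proof. by rewrite !inE !setIdE odd_cardI_symd. Qed.

Lemma bd1_0 : bd1 (set0 : {set {set T}}) = set0.
Proof. by apply/setP=> v; rewrite !inE setIdE set0I cards0. Qed.

Lemma bd1_set1 e : bd1 [set e] = e.
Proof.
apply/setP=> v; rewrite !inE setIdE; case: (boolP (v \in e)) => ve.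
  by rewrite (setIidPl _) ?cards1 // sub1set inE.
rewrite (_ : _ :&: _ = set0) ?cards0 //; apply/setP=> f; rewrite !inE.
by case: eqP => // ->; apply: negbTE.
Qed.

Lemma bd1_symd_eq0 a b : bd1 (symd a b) = set0 :> {set T} <-> bd1 a = bd1 b.
Proof.
split=> [/setP h | h]; apply/setP=> v.
  by have := h v; rewrite in_bd1_symd [RHS]inE; case: (v \in bd1 a); case: (v \in _).
by rewrite in_bd1_symd h addbb inE.
Qed.

Lemma bd2_symd a b : bd2 (symd a b) = symd (bd2 a) (bd2 b).
Proof.
apply/setP=> e; rewrite in_symd !inE !setIdE odd_cardI_symd.
by case: (is_edge e).
Qed.

Lemma bd2_0 : bd2 (set0 : {set {set T}}) = set0.
Proof. by apply/setP=> v; rewrite !inE setIdE set0I cards0 andbF. Qed.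

Lemma bd1_bd2_set1 (t : {set T}) : is_tri t -> bd1 (bd2 [set t]) = set0.
Proof.
move=> /eqP t3; apply/setP=> v; rewrite [RHS]inE [LHS]inE.
have memt e : (e \in bd2 [set t]) = (#|e| == 2%N) && (e \subset t).
  rewrite inE setIdE; congr andb; case: (boolP (e \subset t)) => et.
    by rewrite (setIidPl _) ?cards1 // sub1set inE.
  rewrite (_ : _ :&: _ = set0) ?cards0 //; apply/setP=> f; rewrite !inE.
  by case: eqP => // ->; apply: negbTE.
have [vt | vt] := boolP (v \in t); last first.
  rewrite (_ : [set _ in _ | _] = set0) ?cards0 //; apply/setP=> e.
  rewrite inE memt inE; apply/negP => /andP[/andP[_ /subsetP et] ve].
  by rewrite et in vt.
(* An edge of [t] through [v] is obtained by deleting a vertex other than [v], so there are exactly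
   two. *)
have -> : [set e in bd2 [set t] | v \in e] = [set t :\ x | x in t :\ v].
  apply/setP=> e; rewrite inE memt; apply/idP/imsetP.
    move=> /andP[/andP[/eqP e2 et] ve].
    have /cards1P[x tx] : #|t :\: e| == 1%N.
      by rewrite cardsD (setIidPr et) t3 e2.
    have : x \in t :\: e by rewrite tx inE.
    rewrite inE => /andP[xe xt]; exists x.
      by rewrite !inE xt andbT; apply: contraNneq xe => ->.
    by rewrite -tx setDDr setDv set0U (setIidPr et).
  move=> [x]; rewrite !inE => /andP[xv xt] ->.
  by rewrite subsetDl andbT !inE (eq_sym v) xv vt; have := cardsD1 x t; rewrite t3 xt add1n => -[<-].
rewrite card_in_imset; last first.
  move=> x y; rewrite !inE => /andP[_ xt] /andP[_ yt] /setP /(_ x).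
  by rewrite !inE eqxx xt andbT /=; case: eqP.
by have := cardsD1 v t; rewrite t3 vt add1n => -[<-].
Qed.

Lemma bd1_bd2 (S : {set {set T}}) : (forall t, t \in S -> is_tri t) -> bd1 (bd2 S) = set0.
Proof.
move=> tS; apply: (@chain_ind (fun S => bd1 (bd2 S) = set0)) => [|t a /tS tt IH]; first by rewrite bd2_0 bd1_0.
by rewrite bd2_symd; apply/bd1_symd_eq0; rewrite IH bd1_bd2_set1.
Qed.

Lemma bdry_cycle (X : {set {set T}}) c : bdry X c -> bd1 c = set0.
Proof.
case/existsP=> S /andP[/subsetP SX /eqP ->]; apply: bd1_bd2 => t /SX.
by rewrite inE => /andP[].
Qed.

Lemma bdry_0 (X : {set {set T}}) : bdry X set0.
Proof. by apply/existsP; exists set0; rewrite sub0set bd2_0 eqxx. Qed.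

Lemma bdry_symd (X : {set {set T}}) a b : bdry X a -> bdry X b -> bdry X (symd a b).
Proof.
case/existsP=> S /andP[SX /eqP ->] /existsP[S' /andP[S'X /eqP ->]].
by apply/existsP; exists (symd S S'); rewrite bd2_symd eqxx andbT symd_sub.
Qed.

Lemma bdry_sub (X Y : {set {set T}}) c : X \subset Y -> bdry X c -> bdry Y c.
Proof.
move=> /subsetP XY /existsP[S /andP[SX cS]]; apply/existsP; exists S.
rewrite cS andbT (subset_trans SX) //; apply/subsetP=> t; rewrite !inE.
by case/andP=> /XY ->.
Qed.

(* Over Z/2, a vector outside a subspace is separated from it by a linear form;
   here forms are sets and the pairing is the parity of the intersection. *)
Lemma separating_form (W : {set {set {set T}}}) c :
  set0 \in W -> (forall a b, a \in W -> b \in W -> symd a b \in W) -> c \notin W ->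
  exists2 x : {set {set T}}, odd #|c :&: x| & forall w, w \in W -> ~~ odd #|w :&: x|.
Proof.
move=> W0 Wadd Wc.
pose P (V : {set {set {set T}}}) := [&& set0 \in V,
  [forall a in V, forall b in V, symd a b \in V] & c \notin V].
have addP (V : {set {set {set T}}}) :
    reflect (forall a b, a \in V -> b \in V -> symd a b \in V)
       [forall a in V, forall b in V, symd a b \in V].
  apply: (iffP forall_inP) => h a.
    by move=> b /h /forall_inP; apply.
  by move=> aV; apply/forall_inP=> b; apply: h.
have PW : P W by rewrite /P W0 Wc andbT /=; apply/addP.
(* [V] is a maximal subspace that contains [W] and avoids [c]. Then [half] says that it is a
   hyperplane: if [a] is outside, adjoining [a] must capture [c]. *)
have [V /maxsetP[/and3P[V0 /addP Vadd Vc] Vmax] WV] := maxset_exists PW.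
have half a : a \notin V -> symd a c \in V.
  move=> aV; pose V' := V :|: [set symd a v | v in V].
  have memV' v : (v \in V') = (v \in V) || (symd a v \in V).
    rewrite inE; congr orb; apply/imsetP/idP => [[w wV ->] | avV].
      by rewrite symdK.
    by exists (symd a v); rewrite ?symdK.
  have [cV' | cV'] := boolP (c \in V').
    by move: cV'; rewrite memV' (negbTE Vc).
  case/negP: aV; have <- : V' = V; last by rewrite memV' symdv V0 orbT.
  apply: Vmax; last by apply: subsetUl.
  rewrite /P cV' memV' V0 andbT /=; apply/addP=> v w; rewrite !memV'.
  case/orP=> hv /orP[] hw.
  - by apply/orP; left; exact: Vadd.
  - by apply/orP; right; rewrite symdA (symdC a) -symdA; apply: Vadd.
  - by apply/orP; right; rewrite symdA; apply: Vadd.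
  - by apply/orP; left; have := Vadd _ _ hv hw; rewrite symdACA symdv sym0d.
have notVadd a b : (symd a b \notin V) = (a \notin V) (+) (b \notin V).
  case: (boolP (a \in V)) => aV; case: (boolP (b \in V)) => bV /=.
  - by rewrite Vadd.
  - by apply: contra bV => /(Vadd _ _ aV); rewrite symdK.
  - by apply: contra aV => abV; rewrite -(symdK b a) Vadd // symdC.
  - by apply/negbTE; rewrite negbK -(symd0 (symd a b)) -(symdv c) symdACA Vadd ?half.
(* This is the linear form with kernel [V], read off on single simplices. *)
pose x := [set e | [set e] \notin V].
have xE a : odd #|a :&: x| = (a \notin V).
  apply: (@chain_ind (fun a => odd #|a :&: x| = (a \notin V))) => [|e b _ IH]; first by rewrite set0I cards0 V0.
  rewrite odd_cardI_symd notVadd IH; congr addb.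
  case: (boolP ([set e] \in V)) => eV.
    rewrite (_ : _ :&: _ = set0) ?cards0 //; apply/setP=> f; rewrite !inE.
    by case: eqP => // ->; rewrite eV.
  by rewrite (setIidPl _) ?cards1 // sub1set inE.
exists x; first by rewrite xE.
by move=> w wW; rewrite xE negbK (subsetP WV).
Qed.

(** * Linear matroids of simplices modulo a subspace [B] *)

Definition spanned (B : pred {set {set T}}) (A c : {set {set T}}) : Prop :=
  exists2 X : {set {set T}}, X \subset A & B (symd c X).

Definition indep (B : pred {set {set T}}) (A : {set {set T}}) : Prop :=
  forall X : {set {set T}}, X \subset A -> B X -> X = set0.

(** Over Z/2 a linear combination is a subset, so this is a basis, drawn from [E], of the span of
    [E] in the chains modulo [B]. *)
Definition basis (B : pred {set {set T}}) (E A : {set {set T}}) : Prop :=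
  [/\ A \subset E, indep B A & forall e, e \in E -> spanned B A [set e]].

Section LinearMatroid.
Variable B : pred {set {set T}}.
Hypotheses (B0 : B set0) (Badd : forall a b, B a -> B b -> B (symd a b)).

Lemma spanned_sub A c : c \subset A -> spanned B A c.
Proof. by move=> cA; exists c; rewrite ?symdv. Qed.

Lemma spannedD A a b : spanned B A a -> spanned B A b -> spanned B A (symd a b).
Proof.
move=> [X XA aX] [Y YA bY]; exists (symd X Y); first exact: symd_sub.
by rewrite symdACA; apply: Badd.
Qed.

Lemma spanned_mod A a b : B (symd a b) -> spanned B A b -> spanned B A a.
Proof.
move=> ab [X XA bX]; exists X => //.
by have := Badd ab bX; rewrite -symdA symdK.
Qed.

Lemma spanned_pointwise A c : (forall e, e \in c -> spanned B A [set e]) -> spanned B A c.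
Proof.
move=> cA; apply: (@chain_ind (spanned B A)) => [|e a /cA]; last exact: spannedD.
by apply: spanned_sub; apply: sub0set.
Qed.

Lemma spanned_trans A A' c :
  spanned B A c -> (forall e, e \in A -> spanned B A' [set e]) -> spanned B A' c.
Proof.
move=> [X /subsetP XA cX] AA'; apply: spanned_mod cX _.
by apply: spanned_pointwise => e /XA /AA'.
Qed.

Lemma indep_unspanned A h : indep B A -> h \in A -> ~ spanned B (A :\ h) [set h].
Proof.
move=> iA hA [X /subsetP XA hX].
have : symd [set h] X = set0.
  apply: iA hX; apply: symd_sub; rewrite ?sub1set //.
  by apply/subsetP=> e /XA; rewrite inE => /andP[].
move/setP/(_ h); rewrite in_symd !inE eqxx /=.
by case: (boolP (h \in X)) => // /XA; rewrite !inE eqxx.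
Qed.

(** [X] is the expansion of [f] in the basis; since [h] occurs in it with coefficient 1, the
    relation can be solved for [h]. *)
Lemma basis_swap E A f h X :
  basis B E A -> f \in E -> f \notin A -> X \subset A -> B (symd [set f] X) -> h \in X ->
  basis B E (f |: A :\ h).
Proof.
move=> [AE iA sA] fE fA XA fX hX; have hA := subsetP XA h hX.
have hf : h != f by apply: contraNneq fA => <-.
split.
- by rewrite subUset sub1set fE (subset_trans (subsetDl _ _)).
- move=> Y /subsetP YA YB; have [fY | fY] := boolP (f \in Y).
    have hY : h \notin Y.
      by apply/negP=> /YA; rewrite !inE eqxx (negbTE hf).
    (* Adding the relation for [f] cancels [f] from [Y] and leaves a relation inside [A] in which
       [h] still occurs. *)
    have : symd Y (symd [set f] X) = set0.
      apply: iA; last exact: Badd.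
      apply/subsetP=> e; rewrite !in_symd !inE.
      case: (eqVneq e f) => [-> | ef]; first by rewrite fY (negbTE fA) /= negbK => /(subsetP XA); rewrite (negbTE fA).
      case: (boolP (e \in Y)) => [/YA | _]; last by move=> /(subsetP XA).
      by rewrite !inE (negbTE ef) => /andP[].
    by move/setP/(_ h); rewrite !in_symd !inE (negbTE hY) (negbTE hf) hX.
  apply: iA YB; apply/subsetP=> e eY; have := YA e eY; rewrite !inE.
  by case: eqP => [ef | _ /andP[]//]; rewrite ef (negbTE fY) in eY.
- move=> e /sA sp; apply: spanned_trans sp _ => g gA.
  have [-> | gh] := eqVneq g h; last first.
    by apply: spanned_sub; rewrite sub1set !inE gh gA orbT.
  exists (symd [set h] (symd [set f] X)); last by rewrite symdK.
  apply/subsetP=> i; rewrite !in_symd !inE.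
  case: (eqVneq i h) => [-> | ih /=]; first by rewrite (negbTE hf) hX.
  by case: (eqVneq i f) => //= _ /(subsetP XA).
Qed.

(** Greedy exchange: an element [g] of [G] outside [H] is traded for some [h] of [H] that is no
    heavier. This brings [G] closer to [H] without increasing its weight. *)
Lemma basis_min_weight (R : realFieldType) (w : {set T} -> R) E H G :
  basis B E H ->
  (forall e, e \in E -> spanned B [set x in H | w x <= w e] [set e]) ->
  basis B E G -> \sum_(e in H) w e <= \sum_(e in G) w e.
Proof.
move=> bH gH; have [n] := ubnP #|G :\: H|; elim: n G => // n IH G.
rewrite ltnS => Gn bG; have [GE iG sG] := bG; have [HE iH sH] := bH.
have [GH0 | [g]] := set_0Vmem (G :\: H).
  have GH : G \subset H by rewrite -setD_eq0 GH0.
  suff -> : H = G by [].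
  apply/eqP; rewrite eqEsubset GH andbT; apply/subsetP=> h hH.
  apply/negPn/negP=> hG; apply: (indep_unspanned iH hH).
  apply: spanned_trans (sG h (subsetP HE h hH)) _ => e eG.
  apply: spanned_sub; rewrite sub1set !inE (subsetP GH e eG) andbT.
  by apply: contraNneq hG => <-.
rewrite inE => /andP[gH' gG].
have [Y] := gH g (subsetP GE g gG); rewrite setIdE => YH gY.
(* If [g] occurred in the [G]-expansion of no member of [Y], then [g], being spanned by [Y], would
   be spanned by the rest of [G]. *)
have [h hY [X [XG hX gX]]] : exists2 h, h \in Y &
    exists X : {set {set T}}, [/\ X \subset G, B (symd [set h] X) & g \in X].
  have [/existsP[h /andP[hY /existsP[X /and3P[]]]] | none] := boolP [exists h in Y,
    [exists X : {set {set T}}, [&& X \subset G, B (symd [set h] X) & g \in X]]].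
    by exists h => //; exists X.
  case: (indep_unspanned iG gG).
  have sp : spanned B Y [set g] by exists Y.
  apply: spanned_trans sp _ => h hY.
  have [X XG hX] := sG h (subsetP HE h (subsetP (subset_trans YH (subsetIl _ _)) h hY)).
  exists X => //; apply/subsetP=> e eX; rewrite !inE (subsetP XG e eX) andbT.
  apply: contraNneq none => eg; apply/existsP; exists h; rewrite hY /=.
  by apply/existsP; exists X; rewrite XG hX -eg eX.
have := subsetP YH h hY; rewrite !inE => /andP[hH wh].
have hG : h \notin G.
  apply/negP=> hG; have /setP/(_ g) : symd [set h] X = set0.
    by apply: iG hX; apply: symd_sub; rewrite ?sub1set.
  by rewrite in_symd !inE gX; case: eqP => // gh; rewrite gh hH in gH'.
have bG' := basis_swap bG (subsetP HE h hH) hG XG hX gX.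
apply: le_trans (IH _ _ bG') _.
  apply: leq_trans Gn; apply: proper_card; apply/properP; split.
    apply/subsetP=> e; rewrite !inE => /andP[eH].
    by have [eh | _ /andP[_ ->]] := eqVneq e h; [rewrite eh hH in eH | rewrite eH].
  exists g; rewrite !inE gH' ?gG // eqxx orbF /=.
  by apply: contraNneq hG => <-.
rewrite big_setU1 /=; last by rewrite !inE (negbTE hG) andbF.
by rewrite (big_setD1 g gG) /= lerD2r.
Qed.

End LinearMatroid.
End Chains.

(** * Connectivity and homology of graphs as basis conditions *)

Section Graphs.
Variable T : finType.
Implicit Types (c E G X : {set {set T}}) (e P : {set T}).

Definition cycle : pred {set {set T}} := [pred c | bd1 c == set0].

Lemma cycle0 : cycle set0.
Proof. exact/eqP/bd1_0. Qed.

Lemma cycleD a b : cycle a -> cycle b -> cycle (symd a b).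
Proof. by move=> /eqP a0 /eqP b0; apply/eqP/bd1_symd_eq0; rewrite a0 b0. Qed.

Lemma in_edges X e : (e \in edges X) = (e \in X) && is_edge e.
Proof. by rewrite inE. Qed.

Lemma is_edgeP u v : is_edge [set u; v] = (u != v :> T).
Proof. by rewrite /is_edge cards2; case: (u != v). Qed.

(** No edge crosses the cut, so each edge contributes zero or two endpoints to [P]. *)
Lemma even_bd1_cut c P :
  (forall e, e \in c -> is_edge e /\ (e \subset P \/ [disjoint e & P])) ->
  ~~ odd #|bd1 c :&: P|.
Proof.
move=> cP; apply: (@chain_ind _ (fun c => ~~ odd #|bd1 c :&: P|)).
  by rewrite bd1_0 set0I cards0.
move=> e a /cP [/eqP e2 eP] IH.
have -> : bd1 (symd [set e] a) :&: P =
    ((e :&: P) :\: (bd1 a :&: P)) :|: ((bd1 a :&: P) :\: (e :&: P)).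
  apply/setP=> v; rewrite in_setI in_bd1_symd bd1_set1 !inE.
  by case: (v \in e); case: (odd _); case: (v \in P).
rewrite odd_card_symdiff (negbTE IH) addbF; case: eP => eP.
  by rewrite (setIidPl eP) e2.
by rewrite disjoint_setI0 // cards0.
Qed.

Lemma connect_chain E u v : (forall e, e \in E -> is_edge e) ->
  connect (adjrel E) u v ->
  exists2 c : {set {set T}}, c \subset E & forall x, (x \in bd1 c) = (x == u) (+) (x == v).
Proof.
move=> eE /connectP[p]; elim: p u => [u _ -> | w p IH u /= /andP[uw pw] lastv].
  by exists set0; [apply: sub0set | move=> x; rewrite bd1_0 inE addbb].
have [c cE bc] := IH w pw lastv.
exists (symd [set [set u; w]] c); first by rewrite symd_sub ?sub1set.
move=> x; rewrite in_bd1_symd bd1_set1 bc !inE.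
have := eE _ uw; rewrite is_edgeP; case: (eqVneq x u) => [-> /negbTE -> // | _ _].
by rewrite /= addKb.
Qed.

Lemma chain_connect E u v c : (forall e, e \in E -> is_edge e) ->
  c \subset E -> bd1 c = [set u; v] -> connect (adjrel E) u v.
Proof.
move=> eE /subsetP cE bc; have symE : connect_sym (adjrel E).
  by apply: sym_connect_sym => x y; rewrite /adjrel setUC.
pose P := [set x | connect (adjrel E) u x].
(* [P] is the component of [u]. If [v] were outside it, the boundary of [c] would meet [P] in [u]
   alone, against the parity of a cut. *)
have [|vP] := boolP (v \in P); first by rewrite inE.
have /even_bd1_cut : forall e, e \in c -> is_edge e /\ (e \subset P \/ [disjoint e & P]).
  move=> e /cE eE'; split; [exact: eE eE' | ].
  have /cards2P[x [y [xy exy]]] := eE e eE'.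
  have adj : adjrel E x y by rewrite /adjrel -exy.
  have [xP | xP] := boolP (x \in P); [left | right].
    rewrite exy subUset !sub1set xP inE; rewrite inE in xP.
    exact: connect_trans xP (connect1 adj).
  rewrite exy disjoints_subset subUset !sub1set !inE; rewrite inE in xP; rewrite xP /=.
  by apply: contra xP => uy; apply: connect_trans uy _; rewrite symE; apply: connect1.
rewrite bc (_ : _ :&: P = [set u]) ?cards1 //.
apply/setP=> x; rewrite !inE; case: (eqVneq x u) => [-> /= | _ /=]; first exact: connect0.
by case: eqP => // ->; apply/negbTE; rewrite inE in vP.
Qed.

(** A path between the ends of an edge closes up with that edge to a cycle; conversely, a chain with
    the same boundary as the edge connects its ends. *)
Lemma spansP E X : E \subset edges X ->
  spans E X <-> forall e, e \in edges X -> spanned cycle E [set e].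
Proof.
move=> EX; have eE e : e \in E -> is_edge e.
  by move/(subsetP EX); rewrite in_edges => /andP[].
split=> [[_ conn] e eX | sp].
  have := eX; rewrite in_edges => /andP[_ e2].
  have /cards2P[x [y [xy exy]]] := e2.
  have [|c cE bc] := @connect_chain E x y eE.
    by apply: conn; apply: connect1; rewrite /adjrel -exy.
  exists c => //; apply/eqP/bd1_symd_eq0; rewrite bd1_set1.
  apply/setP=> z; rewrite bc exy !inE.
  by case: (eqVneq z x) => [-> | _]; rewrite // (negbTE xy).
split=> // u v; apply: connect_sub => x y xy.
have [c cE /eqP/bd1_symd_eq0] := sp _ xy; rewrite bd1_set1 => /esym.
exact: chain_connect.
Qed.

(** Injectivity on H_1 is independence modulo boundaries, because boundaries are cycles. For
    generation, an edge is closed to a cycle by a path in [G], and surjectivity on H_1 replaces that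
    cycle by one in [G]. *)
Lemma spans_H1isoP G X : G \subset edges X ->
  (spans G X /\ H1iso G X) <-> basis (bdry X) (edges X) G.
Proof.
move=> GX; split=> [[/(spansP GX) sG [inj surj]] | [_ iG sG]].
  split=> // [c cG cB | e eX].
    exact: inj cG (bdry_cycle cB) cB.
  have [c cG /eqP ec] := sG e eX.
  have [|w [wG _] wB] := surj _ _ ec.
    by apply: symd_sub; rewrite ?sub1set // (subset_trans cG).
  by exists (symd c w); [apply: symd_sub | rewrite symdA].
split.
  apply/(spansP GX)=> e /sG[c cG cB]; exists c => //.
  exact/eqP/bdry_cycle/cB.
split=> [z zG _ zB | z zX z0]; first exact: iG.
have [w wG zw] : spanned (bdry X) G z.
  apply: spanned_pointwise => [| | e /(subsetP zX)/sG //]; first exact: bdry_0.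
  exact: bdry_symd.
exists w => //; split=> //.
by have /bd1_symd_eq0 <- := bdry_cycle zw.
Qed.

Lemma spanning_treeP K E : spanning_tree K E <-> basis cycle (edges K) E.
Proof.
split=> [[sE iE] | [EK iE sE]].
  have EK := sE.1; split=> // [c cE /eqP|]; first exact: iE.
  exact/(spansP EK).
by split=> [|c cE c0]; [apply/(spansP EK) | apply: iE cE _; apply/eqP].
Qed.

End Graphs.

(** * Leading sets of the death system and their exchange *)

Section LeadingSwap.
Variables (T : finType) (R : realFieldType).
Variables (K : {set {set T}}) (ent : {set T} -> R) (mst : {set {set T}}) (alpha : R).
Implicit Types (S D J x : {set {set T}}) (e a h : {set T}).

Local Notation solves := (solves K ent mst alpha).
Local Notation inKer := (inKer K ent mst alpha).
Local Notation leading := (leading K ent mst alpha).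

Lemma solvesP S x : reflect (forall J, inKer S J -> ~~ odd #|J :&: x|) (solves S x).
Proof. by apply: (iffP forallP) => h J; [apply/implyP | apply/implyP/h]. Qed.

Lemma solves0 S : solves S set0.
Proof. by apply/solvesP=> J _; rewrite setI0 cards0. Qed.

Lemma solvesD S x y : solves S x -> solves S y -> solves S (symd x y).
Proof.
move=> /solvesP sx /solvesP sy; apply/solvesP=> J kJ.
by rewrite setIC odd_cardI_symd !(setIC _ J) (negbTE (sx J kJ)) (negbTE (sy J kJ)).
Qed.

Lemma inKer0 S : inKer S set0.
Proof.
rewrite /Defs.inKer sub0set /=; apply/existsP; exists set0; apply/existsP; exists set0.
by rewrite !sub0set bd2_0 symdv eqxx.
Qed.

Lemma inKerD S I J : inKer S I -> inKer S J -> inKer S (symd I J).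
Proof.
move=> /andP[IS /existsP[M /existsP[Tr /and3P[Ma Tra /eqP eI]]]].
move=> /andP[JS /existsP[M' /existsP[Tr' /and3P[Ma' Tra' /eqP eJ]]]].
rewrite /Defs.inKer symd_sub //=; apply/existsP; exists (symd M M').
by apply/existsP; exists (symd Tr Tr'); rewrite !symd_sub //= bd2_symd eI eJ symdACA.
Qed.

Lemma inKerP S J :
  reflect (J \subset S /\ spanned (bdry (Q K ent alpha)) (mst_at ent mst alpha) J)
    (inKer S J).
Proof.
apply: (iffP andP) => [[JS /existsP[M /existsP[Tr /and3P[Ma Tra /eqP eJ]]]] | [JS [M Ma]]].
  split=> //; exists M => //; apply/existsP; exists Tr.
  by rewrite Tra eJ symdC symdK eqxx.
case/existsP=> Tr /andP[Tra /eqP eJ]; split=> //.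
apply/existsP; exists M; apply/existsP; exists Tr.
by rewrite Ma Tra -eJ symdC -symdA symdv symd0 eqxx.
Qed.

Lemma leading_uniq S D x x' : leading S D ->
  x \subset S -> x' \subset S -> solves S x -> solves S x' ->
  x :\: D = x' :\: D -> x = x'.
Proof.
move=> [DS lead] xS x'S sx sx' xx'.
have [|x0 [_ uniq]] := lead (x :\: D); first exact: setSD.
by rewrite -(uniq x) // -(uniq x').
Qed.

(** For [j] in [J], the solution whose only nonzero free variable is [j] would meet [J] in [j] alone
    and violate the equation of [J]. *)
Lemma leading_ker_free S D J : leading S D -> inKer S J -> J \subset S :\: D -> J = set0.
Proof.
move=> [DS lead] kJ JSD; apply/eqP; rewrite -subset0; apply/subsetP=> j jJ.
have [|x [[xS xD /solvesP/(_ J kJ) even] _]] := lead [set j].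
  by rewrite sub1set (subsetP JSD).
move: even.
suff -> : J :&: x = [set j] by rewrite cards1.
apply/setP=> e; move/setP/(_ e): xD; rewrite !inE.
have [/(subsetP JSD) | ] := boolP (e \in J); first by rewrite inE => /andP[->].
by move=> eJ _; apply/esym; apply: contraNF eJ => /eqP ->.
Qed.

(* Otherwise a separating form would be a nonzero solution without free part. *)
Lemma leading_spanned S D d : leading S D -> d \in D ->
  exists2 J, inKer S J & symd [set d] J \subset S :\: D.
Proof.
move=> lead dD; have [DS _] := lead.
(* The sum of the kernel and the chains of free edges; the claim is that it contains [d]. *)
pose W := [set c : {set {set T}} |
  [exists J : {set {set T}}, inKer S J && (symd c J \subset S :\: D)]].
have kerW J : inKer S J -> J \in W.
  by move=> kJ; rewrite inE; apply/existsP; exists J; rewrite kJ symdv sub0set.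
have [|dW] := boolP ([set d] \in W).
  by rewrite inE => /existsP[J /andP[kJ dJ]]; exists J.
have [|a b|x oddx Wx] := separating_form _ _ dW; first exact/kerW/inKer0.
  rewrite !inE => /existsP[I /andP[kI aI]] /existsP[J /andP[kJ bJ]].
  by apply/existsP; exists (symd I J); rewrite inKerD // symdACA symd_sub.
have dx : d \in x.
  apply: contraLR oddx => dx; rewrite (_ : _ :&: _ = set0) ?cards0 //.
  by apply/setP=> e; rewrite !inE; case: eqP => // ->; apply/negbTE.
have : x :&: S = set0.
  apply: (leading_uniq lead); rewrite ?subsetIr ?sub0set ?solves0 //.
    apply/solvesP=> J kJ; rewrite (_ : _ :&: _ = J :&: x) ?Wx ?kerW //.
    by rewrite (setIC x) setIA (setIidPl (proj1 (inKerP _ _ kJ))).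
  rewrite set0D; apply/eqP; rewrite -subset0; apply/subsetP=> s.
  rewrite !inE => /and3P[sD sx sS].
  have /Wx : [set s] \in W.
    rewrite inE; apply/existsP; exists set0.
    by rewrite inKer0 symd0 sub1set inE sD.
  by rewrite (setIidPl _) ?cards1 // sub1set.
by move/setP/(_ d); rewrite !inE dx (subsetP DS).
Qed.

(** The equation of [J] involves [a] as its only leading variable and has coefficient 1 at the free
    variable [h], so it can be solved for [h] instead of [a]. *)
Lemma leading_swap S D J a h : leading S D -> inKer S J -> a \in D -> h \in S :\: D ->
  a \in J -> h \in J -> J \subset a |: (S :\: D) -> leading S (h |: D :\ a).
Proof.
move=> lead kJ aD hSD aJ hJ JSD; have [DS ex] := lead.
have [hS hD] : h \in S /\ h \notin D by move: hSD; rewrite inE => /andP[].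
have aS := subsetP DS a aD; have ah : a != h by apply: contraNneq hD => <-.
(* [xh] is the solution whose only nonzero old free variable is [h]; the equation of [J] forces it
   to contain [a]. *)
have [|xh [[xhS xhD sxh] _]] := ex [set h]; first by rewrite sub1set.
have axh : a \in xh.
  apply: contraT => axh; move/solvesP/(_ J kJ): (sxh).
  rewrite (_ : _ :&: _ = [set h]) ?cards1 //; apply/setP=> e.
  move/setP/(_ e): xhD; rewrite !inE.
  have [/(subsetP JSD) | ] := boolP (e \in J).
    by rewrite !inE => /predU1P[-> _ | /andP[-> //]]; rewrite (negbTE axh) (negbTE ah).
  by move=> eJ _; apply/esym; apply: contraNF eJ => /eqP ->.
(* The difference of two such solutions has no old free variable except possibly [h], so it is [xh]
   or zero. It cannot be [xh], which contains the new free variable [a]. *)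
have uniq x x' : x \subset S -> x' \subset S -> solves S x -> solves S x' ->
    x :\: (h |: D :\ a) = x' :\: (h |: D :\ a) -> x = x'.
  move=> xS x'S sx sx' /setP xx'; have dS := symd_sub xS x'S; have sd := solvesD sx sx'.
  have dL e : e \in symd x x' -> e \in h |: D :\ a.
    move=> ed; apply: contraTT ed => eL; move: (xx' e).
    by rewrite in_symd in_setD [in RHS]in_setD eL /= => ->; rewrite addbb.
  have [hd | hd] := boolP (h \in symd x x').
    have dxh : symd x x' = xh.
      apply: (leading_uniq lead) => //; rewrite xhD; apply/setP=> e.
      rewrite in_setD in_set1; case: (eqVneq e h) => [-> | eh]; first by rewrite hD hd.
      by apply/negP=> /andP[eD /dL]; rewrite !inE (negbTE eh) (negbTE eD) andbF.
    by have := axh; rewrite -dxh => /dL; rewrite !inE eqxx (negbTE ah).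
  have d0 : symd x x' = set0.
    apply: (leading_uniq lead); rewrite ?sub0set ?solves0 // set0D.
    apply/setP=> e; rewrite in_setD [RHS]inE; apply/negP=> /andP[eD ed].
    have := dL e ed; rewrite !inE (negbTE eD) andbF orbF => /eqP eh.
    by rewrite -eh ed in hd.
  by rewrite -[x](symd0) -d0 symdK.
split=> [|y ySL].
  by rewrite subUset sub1set hS (subset_trans (subsetDl _ _)).
suff [x [xS xL sx]] : exists x : {set {set T}},
    [/\ x \subset S, x :\: (h |: D :\ a) = y & solves S x].
  exists x; split=> // x' [x'S x'L sx']; apply: uniq => //; by rewrite xL.
have [|x0 [[x0S x0D sx0] _]] := ex (y :\ a).
  apply/subsetP=> e; rewrite !inE => /andP[ea /(subsetP ySL)].
  by rewrite !inE (negbTE ea) /= negb_or => /andP[/andP[_ ->]].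
have hy : h \notin y by apply/negP=> /(subsetP ySL); rewrite !inE eqxx.
have yD e : e \in y -> e != a -> e \notin D.
  by move/(subsetP ySL); rewrite !inE => /andP[+ _] ea; rewrite ea negb_or => /andP[].
(* Adding [xh] flips the coordinate at [a] and changes no other new free variable. *)
exists (if (a \in x0) == (a \in y) then x0 else symd x0 xh).
have x0E e : e \notin D -> (e \in x0) = (e \in y).
  move=> eD; move/setP/(_ e): x0D; rewrite !inE eD /= => ->.
  by case: eqP eD => // ->; rewrite aD.
have xhE e : e \notin D -> (e \in xh) = (e == h).
  by move=> eD; move/setP/(_ e): xhD; rewrite !inE eD.
case: eqP => axy; split; rewrite ?symd_sub ?solvesD //.
  apply/setP=> e; rewrite !inE; case: (eqVneq e h) => [-> | eh] /=.
    by rewrite (negbTE hy).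
  case: (eqVneq e a) => [-> | ea] /=; first by rewrite axy.
  case: (boolP (e \in D)) => eD /=; last exact: x0E.
  by apply/esym; apply: contraTF eD => /yD; apply.
apply/setP=> e; rewrite in_setD in_symd !inE; case: (eqVneq e h) => [-> | eh] /=.
  by rewrite (negbTE hy).
case: (eqVneq e a) => [-> | ea] /=.
  by rewrite axh; move/eqP: axy; case: (a \in x0); case: (a \in y).
case: (boolP (e \in D)) => eD /=.
  by apply/esym; apply: contraTF eD => /yD; apply.
by rewrite x0E // xhE // (negbTE eh) addbF.
Qed.

End LeadingSwap.

(** * Tree edges and critical edges in the order of entry *)

Section Skeleton.
Variables (T : finType) (R : realFieldType).
Variables (K : {set {set T}}) (ent : {set T} -> R) (mst : {set {set T}}).
Variables (rk : {set T} -> nat) (death : {set T} -> option R).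
Implicit Types (A G X Z : {set {set T}}) (e f h : {set T}) (alpha beta : R).
Hypothesis mstP : is_MST K ent mst.
Hypothesis rkP : compatible_order K ent mst rk.
Hypothesis deathP : deaths_ok K ent mst rk death.

Local Notation Q := (Q K ent).
Local Notation critical := (critical K ent rk).
Local Notation alive := (alive_set K ent rk death).
Local Notation dying := (dying_set K ent rk death).
Local Notation HoPeS := (HoPeS K ent mst rk death).

Lemma spannedS (B B' : pred {set {set T}}) A A' c :
  A \subset A' -> (forall b, B b -> B' b) -> spanned B A c -> spanned B' A' c.
Proof. by move=> AA' BB' [X XA cX]; exists X; [apply: subset_trans AA' | apply: BB']. Qed.

Lemma mst_basis : basis (@cycle T) (edges K) mst.
Proof. by apply/spanning_treeP; case: mstP. Qed.

Lemma mst_edge e : e \in mst -> e \in edges K.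
Proof. by case: mst_basis => /subsetP h _ _; apply: h. Qed.

Lemma edge_in e : e \in edges K -> e \in K.
Proof. by rewrite in_edges => /andP[]. Qed.

Lemma in_edgesQ alpha e : (e \in edges (Q alpha)) = (e \in edges K) && (ent e <= alpha).
Proof. by rewrite !inE -!andbA; congr andb; rewrite andbC. Qed.

Lemma rk_ent e f : e \in edges K -> f \in edges K -> (rk f <= rk e)%N -> ent f <= ent e.
Proof.
case: rkP => _ mono _ _ /edge_in eK /edge_in fK; rewrite leqNgt => /negP rfe.
by rewrite leNgt; apply/negP=> /(mono _ _ eK fK).
Qed.

(** Exchanging [h] for [e] gives another spanning tree, so [h] is no longer than [e]; the order puts
    tree edges first among edges of equal length. *)
Lemma mst_rk_lt e X h : e \in edges K -> e \notin mst ->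
  X \subset mst -> cycle (symd [set e] X) -> h \in X -> (rk h < rk e)%N.
Proof.
move=> eK em Xm eX hX; have hm := subsetP Xm h hX; have hK := mst_edge hm.
have /spanning_treeP := basis_swap (@cycle0 T) (@cycleD T) mst_basis eK em Xm eX hX.
case: mstP => _ /[apply]; rewrite /len (big_setD1 h hm) big_setU1 /=; last first.
  by rewrite !inE (negbTE em) andbF.
rewrite lerD2r ler_pM2l // le_eqVlt; case: rkP => _ mono _ tie.
case/orP=> [/eqP he | ]; first exact: tie.
by apply: mono; apply: edge_in.
Qed.

(** Otherwise each non-tree edge of [Z] could be replaced by its tree path, whose edges precede it
    and hence avoid [h]; so [h] would be spanned by the rest of the tree. *)
Lemma mst_not_last h Z : h \in mst -> cycle Z -> h \in Z ->
  (forall f, f \in Z -> f != h -> f \in edges K /\ (rk f < rk h)%N) -> False.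
Proof.
move=> hm Zc hZ Zh; have [mK im sm] := mst_basis.
apply: (indep_unspanned im hm).
apply: (spanned_trans (@cycle0 T) (@cycleD T) (A := Z :\ h)).
  exists (Z :\ h) => //; rewrite (_ : symd _ _ = Z) //.
  by apply/setP=> e; rewrite in_symd !inE; case: eqP => // ->; rewrite hZ.
move=> f; rewrite !inE => /andP[fh fZ]; have [fK rfh] := Zh f fZ fh.
have [fm | fm] := boolP (f \in mst).
  by apply: (spanned_sub (@cycle0 T)); rewrite sub1set !inE fh.
have [X Xm fX] := sm f fK; exists X => //.
apply/subsetP=> g gX; rewrite !inE (subsetP Xm g gX) andbT.
apply: contraTneq rfh => <-; rewrite -leqNgt ltnW //.
exact: mst_rk_lt fX gX.
Qed.

Lemma mst_noncritical e : e \in mst -> critical e = false.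
Proof.
move=> em; apply/negP=> /andP[_ /existsP[Z /and4P[/subsetP ZK eZ Zc _]]].
apply: (mst_not_last em Zc eZ) => f /ZK; rewrite !inE => /orP[| /eqP-> /eqP //].
by move=> /andP[/andP[-> ->] ->].
Qed.

(** The tree path of [e] consists of earlier edges and closes a cycle with [e]. As [e] is not
    critical, this cycle is homologous at the entry scale of [e] to a cycle of earlier edges. *)
Lemma noncritical_spanned e : e \in edges K -> e \notin mst -> ~~ critical e ->
  spanned (bdry (Q (ent e))) (edges (before K rk e)) [set e].
Proof.
move=> eK em; have [mK im sm] := mst_basis.
have [X Xm eX] := sm e eK; rewrite /Defs.critical eK /=.
have Xb : X \subset edges (before K rk e).
  apply/subsetP=> f fX; have := mst_edge (subsetP Xm f fX).
  by rewrite !inE => /andP[-> ->]; rewrite (mst_rk_lt eK em Xm eX).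
move/existsPn/(_ (symd [set e] X)); rewrite (eqP eX) eqxx !negb_and !negbK.
have -> : symd [set e] X \subset edges (before K rk e) :|: [set e].
  by apply: symd_sub; [apply: subsetUr | apply: subset_trans Xb (subsetUl _ _)].
have -> : e \in symd [set e] X.
  by rewrite in_symd in_set1 eqxx /=; apply: contra em => /(subsetP Xm).
case/existsP=> w /and3P[wb _ ew]; exists (symd X w); first exact: symd_sub.
by rewrite symdA.
Qed.

(** * Death labels and alive edges at a scale *)

Lemma critical_edge e : critical e -> e \in edges K.
Proof. by case/andP. Qed.

Lemma ent_le_death e d : critical e -> death e = Some d -> ent e <= d.
Proof.
move=> ce de; have [/subsetP DS _ _] := deathP d.
by have /DS : e \in dying d; rewrite !inE ce ?de //= => /andP[].
Qed.

(** The alive set still contains the edges that die exactly at [alpha], so these are taken out. Tree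
    edges are never critical and escape the death filter. *)
Lemma HoPeSE alpha : HoPeS alpha = mst_at ent mst alpha :|: alive alpha :\: dying alpha.
Proof.
apply/setP=> e; rewrite !inE; have [em | em] /= := boolP (e \in mst).
  by rewrite mst_noncritical //= andbT andbF orbF.
case: (critical e) => //=; rewrite ler_pM2l //; case: (death e) => [d|] /=.
  rewrite (inj_eq Some_inj) andbCA; congr andb.
  by rewrite -ltNge lt_neqAle eq_sym.
by rewrite !andbT.
Qed.

(* Greedy criterion: such an [A] contains a minimum-weight basis of
   C_1(Q(alpha))/B_1(Q(alpha)), and every independent such [A] is one. *)
Definition lightly_spanning alpha A : Prop :=
  forall e, e \in edges (Q alpha) ->
    spanned (bdry (Q alpha)) [set x in A | ent x <= ent e] [set e].

(** The size of this set is the induction measure that replaces induction over real scales. *)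
Definition dead_before alpha : {set {set T}} :=
  [set e | if death e is Some d then d < alpha else false].

Lemma Q_mono alpha beta : alpha <= beta -> Q alpha \subset Q beta.
Proof.
move=> ab; apply/subsetP=> s; rewrite !inE => /andP[-> sa]; exact: le_trans ab.
Qed.

(** By induction on rank: a noncritical edge outside the tree reduces to earlier edges, and a
    critical edge already dead is spanned by the skeleton at an earlier death. *)
Lemma alive_lightly_spanning alpha :
  (forall e d, death e = Some d -> d < alpha -> lightly_spanning d (HoPeS d)) ->
  lightly_spanning alpha (mst_at ent mst alpha :|: alive alpha).
Proof.
move=> IH e; have [n] := ubnP (rk e); elim: n e => // n IHn e; rewrite ltnS => en.
rewrite in_edgesQ => /andP[eK ea].
have [eA | eA] := boolP (e \in mst_at ent mst alpha :|: alive alpha).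
  by apply: spanned_sub; [exact: bdry_0 | rewrite sub1set inE eA lexx].
move: eA; rewrite !inE negb_or ler_pM2l // ea andbT => /andP[em].
have [ce /= | ce _] := boolP (critical e).
  case de: (death e) => [d0|//]; rewrite -ltNge => d0a.
  (* The hypothesis is used at the largest label [d] below [alpha]: no label lies strictly between,
     so [HoPeS d] consists of tree edges and edges alive at [alpha]. The default 0 is never read on
     [dead_before alpha]. *)
  pose dd f := odflt 0 (death f).
  have e_dead : e \in dead_before alpha by rewrite inE de.
  have [f + fmax] : exists2 f, f \in dead_before alpha &
      forall g, g \in dead_before alpha -> dd g <= dd f.
    by case: (arg_maxP dd e_dead) => f fdead fmax; exists f.
  rewrite inE; case df: (death f) => [d|//] da.
  have dmax g d' : death g = Some d' -> d' < alpha -> d' <= d.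
    move=> dg d'a; have : dd g <= dd f by apply: fmax; rewrite inE dg.
    by rewrite /dd dg df.
  have ed : ent e <= d by apply: le_trans (ent_le_death ce de) (dmax e d0 de d0a).
  have := IH f d df da e; rewrite in_edgesQ eK ed => /(_ isT).
  apply: spannedS; last by move=> b; apply/bdry_sub/Q_mono/ltW.
  apply/subsetP=> g; rewrite !inE !ler_pM2l // => /andP[/and3P[mcg gd alg] ->].
  rewrite (le_trans gd (ltW da)) andbT /=; case/orP: mcg => [-> // | cg].
  rewrite cg /= in alg *; case dg: (death g) alg => [d'|]; rewrite ?orbT //.
  rewrite -ltNge => dd'; apply/orP; right; rewrite leNgt; apply/negP=> /(dmax _ _ dg).
  by rewrite leNgt dd'.
have sp := noncritical_spanned eK em ce.
have {}sp : spanned (bdry (Q alpha)) (edges (before K rk e)) [set e].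
  by apply: spannedS sp => // b; apply/bdry_sub/Q_mono.
apply: (spanned_trans (@bdry_0 _ _) (@bdry_symd _ _) sp) => f.
rewrite !inE -andbA => /and3P[fK rf f2].
have fE : f \in edges K by rewrite in_edges fK.
have fe := rk_ent eK fE (ltnW rf).
apply: spannedS (IHn f _ _) => //.
- by apply/subsetP=> g; rewrite !inE => /andP[-> gf]; apply: le_trans gf fe.
- exact: leq_trans rf en.
- by rewrite in_edgesQ fE (le_trans fe).
Qed.

(** * The reduced skeleton as a basis and its greedy property *)

Lemma HoPeS_sub alpha : HoPeS alpha \subset edges (Q alpha).
Proof.
apply/subsetP=> e; rewrite in_edgesQ inE ler_pM2l // => /and3P[+ -> _].
by rewrite andbT => /orP[/mst_edge | /critical_edge].
Qed.

(** The non-tree part of a bounding chain is a kernel element without leading edges, hence zero;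
    what remains is a cycle in the tree. *)
Lemma HoPeS_indep alpha : indep (bdry (Q alpha)) (HoPeS alpha).
Proof.
move=> c cH cB; have [_ lead _] := deathP alpha; rewrite HoPeSE in cH.
have cSE : c :&: alive alpha = c :\: mst.
  apply/setP=> e; rewrite in_setI in_setD andbC; have [ec | ] := boolP (e \in c); last by rewrite !andbF.
  rewrite !andbT; have := subsetP cH e ec; rewrite !inE.
  have [/mst_noncritical -> // | em] := boolP (e \in mst).
  by rewrite /= => /andP[].
have cS0 : c :&: alive alpha = set0.
  apply: (leading_ker_free lead).
    apply/inKerP; split; first exact: subsetIr.
    exists (c :&: mst).
      apply/subsetP=> e; rewrite inE => /andP[/(subsetP cH) + em].
      by rewrite !inE em mst_noncritical //= ?andbF ?orbF.
    rewrite (_ : symd _ _ = c) // cSE; apply/setP=> e.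
    by rewrite in_symd !inE; case: (e \in c); case: (e \in mst).
  rewrite cSE; apply/subsetP=> e; rewrite inE => /andP[em /(subsetP cH)].
  by rewrite !inE (negbTE em).
have [_ im _] := mst_basis; apply: im; first by rewrite -setD_eq0 -cSE cS0.
exact/eqP/bdry_cycle/cB.
Qed.

Lemma HoPeS_spanned_dying alpha e : e \in dying alpha ->
  spanned (bdry (Q alpha)) (HoPeS alpha) [set e].
Proof.
have [_ lead _] := deathP alpha => eD.
have [J /inKerP[_ [M Ma JM]] eJ] := leading_spanned lead eD.
exists (symd (symd [set e] J) M); rewrite ?HoPeSE.
  apply: symd_sub; first exact: subset_trans eJ (subsetUr _ _).
  exact: subset_trans Ma (subsetUl _ _).
by rewrite symdA symdK.
Qed.

Lemma HoPeS_basis alpha :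
  lightly_spanning alpha (mst_at ent mst alpha :|: alive alpha) ->
  basis (bdry (Q alpha)) (edges (Q alpha)) (HoPeS alpha).
Proof.
move=> light; split; [exact: HoPeS_sub | exact: HoPeS_indep | move=> e /light sp].
apply: (spanned_trans (@bdry_0 _ _) (@bdry_symd _ _) sp) => f.
rewrite inE => /andP[fA _]; have [fD | fD] := boolP (f \in dying alpha).
  exact: HoPeS_spanned_dying.
apply: spanned_sub; first exact: bdry_0.
by rewrite sub1set HoPeSE in_setU in_setD fD -in_setU.
Qed.

(* If not, exchanging [a] with the latest edge of [X] would give a leading set
   of greater combined birth; that edge is not in the tree, being last on a cycle. *)
Lemma dying_circuit_light alpha a X : a \in dying alpha -> X \subset HoPeS alpha ->
  bdry (Q alpha) (symd [set a] X) -> forall h, h \in X -> ent h <= ent a.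
Proof.
move=> aD XH aX h0 h0X; rewrite leNgt; apply/negP=> ah0.
have [DS lead elder] := deathP alpha.
have [h hX hmax] : exists2 h, h \in X & forall f, f \in X -> (rk f <= rk h)%N.
  by case: (arg_maxnP rk h0X) => h hX hmax; exists h.
have XK f : f \in X -> f \in edges K.
  by move=> /(subsetP XH)/(subsetP (HoPeS_sub alpha)); rewrite in_edgesQ => /andP[].
have aK : a \in edges K by move: aD; rewrite inE => /andP[/critical_edge].
have ah : ent a < ent h by apply: lt_le_trans ah0 (rk_ent (XK h hX) (XK h0 h0X) (hmax h0 h0X)).
have ahn : a != h by apply: contraTneq ah => ->; rewrite ltxx.
have [inj mono _ _] := rkP.
have hm : h \notin mst.
  apply/negP=> hm; apply: (mst_not_last hm (Z := symd [set a] X)).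
  - exact/eqP/bdry_cycle/aX.
  - by rewrite in_symd in_set1 hX eq_sym (negbTE ahn).
  move=> f; rewrite in_symd in_set1; case: (eqVneq f a) => [-> _ _ | _ /= fX fh].
    by split=> //; apply: mono => //; apply: edge_in => //; apply: XK.
  split; first exact: XK.
  rewrite ltn_neqAle hmax // andbT; apply: contraNneq fh => rfh.
  by apply/eqP; apply: inj rfh; apply/edge_in/XK.
have hSD : h \in alive alpha :\: dying alpha.
  by have := subsetP XH h hX; rewrite HoPeSE in_setU inE (negbTE hm).
have am : a \notin mst.
  by apply/negP=> /mst_noncritical ca; move: aD; rewrite inE ca.
have hS : h \in alive alpha by move: hSD; rewrite inE => /andP[].
have aS := subsetP DS a aD.
(* [J] is the alive part of the bounding cycle formed by [a] and [X]. The rest of the cycle lies in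
   the tree, so [J] is in the kernel. *)
pose J := symd [set a] (X :&: alive alpha).
have aXn : a \notin X.
  by apply/negP=> /(subsetP XH); rewrite HoPeSE !in_setU in_setD aD inE (negbTE am).
have kJ : inKer K ent mst alpha (alive alpha) J.
  apply/inKerP; split; first by rewrite symd_sub ?sub1set ?subsetIr.
  exists (X :\: alive alpha).
    apply/subsetP=> f; rewrite in_setD => /andP[fS /(subsetP XH)].
    by rewrite HoPeSE in_setU in_setD (negbTE fS) andbF orbF.
  rewrite /J -symdA (_ : symd (X :&: _) _ = X) //; apply/setP=> f.
  by rewrite in_symd in_setI in_setD; case: (f \in X); case: (f \in alive_set _ _ _ _ _).
have := elder _ (leading_swap lead kJ aD hSD _ _ _).
rewrite big_setU1 /=; last first.
  by move: hSD; rewrite !in_setD in_set1 => /andP[/negbTE -> _]; rewrite andbF.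
rewrite (big_setD1 a aD) /= lerD2r leNgt ah /= => contra.
suff : false by []; apply: contra.
- by rewrite in_symd in_set1 eqxx in_setI (negbTE aXn).
- by rewrite in_symd in_set1 in_setI hX hS eq_sym (negbTE ahn).
- apply/subsetP=> f; rewrite in_symd in_setU !in_set1 in_setI.
  case: eqP => //= _ /andP[/(subsetP XH) + fS].
  rewrite HoPeSE in_setU inE => /orP[/andP[/mst_noncritical cf _] | //].
  by rewrite inE cf in fS.
Qed.

(** A dying edge is replaced by its expansion in the skeleton, whose edges are no longer than it, so
    the length bound survives. *)
Lemma HoPeS_lightly_spanning alpha :
  lightly_spanning alpha (mst_at ent mst alpha :|: alive alpha) ->
  lightly_spanning alpha (HoPeS alpha).
Proof.
move=> light e eQ; have [_ _ sH] := HoPeS_basis light.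
apply: (spanned_trans (@bdry_0 _ _) (@bdry_symd _ _) (light e eQ)) => f.
rewrite inE => /andP[fA fe]; have [fD | fD] := boolP (f \in dying alpha).
  have [X XH fX] := HoPeS_spanned_dying fD; exists X => //.
  apply/subsetP=> h hX; rewrite inE (subsetP XH h hX).
  exact: le_trans (dying_circuit_light fD XH fX hX) fe.
apply: spanned_sub; first exact: bdry_0.
by rewrite sub1set inE fe andbT HoPeSE in_setU in_setD fD -in_setU.
Qed.

Lemma mst_alive_lightly_spanning alpha :
  lightly_spanning alpha (mst_at ent mst alpha :|: alive alpha).
Proof.
have [n] := ubnP #|dead_before alpha|; elim: n alpha => // n IH alpha; rewrite ltnS => dn.
apply: alive_lightly_spanning => e d de da; apply/HoPeS_lightly_spanning/IH.
apply: leq_trans dn; apply: proper_card; apply/properP; split.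
  apply/subsetP=> f; rewrite !inE; case: (death f) => // d' d'd; exact: lt_trans da.
(* The edge [e] dies at [d] itself, so the strict inequality in [dead_before] makes the measure
   drop. *)
by exists e; rewrite !inE de ?ltxx.
Qed.

Lemma HoPeS_min_len alpha G : basis (bdry (Q alpha)) (edges (Q alpha)) G ->
  len ent (HoPeS alpha) <= len ent G.
Proof.
have light := @mst_alive_lightly_spanning alpha.
apply: (basis_min_weight (w := fun e => 2 * ent e) (@bdry_0 _ _) (@bdry_symd _ _) (HoPeS_basis light)).
move=> e /(HoPeS_lightly_spanning light); apply: spannedS => //.
by apply/subsetP=> f; rewrite !in_set => /andP[fH fe]; rewrite fH ler_pM2l.
Qed.

End Skeleton.

Theorem mainTheorem9 (T : finType) (R : realFieldType)
    (K : {set {set T}}) (ent : {set T} -> R) (mst : {set {set T}})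
    (rk : {set T} -> nat) (death : {set T} -> option R) :
  filtration K ent ->
  is_MST K ent mst ->
  compatible_order K ent mst rk ->
  deaths_ok K ent mst rk death ->
  forall alpha : R, 0 < alpha ->
    let H := HoPeS K ent mst rk death alpha in
    [/\ spans H (Q K ent alpha), H1iso H (Q K ent alpha) &
        forall G : {set {set T}}, spans G (Q K ent alpha) -> H1iso G (Q K ent alpha) ->
          len ent H <= len ent G].
Proof.
move=> _ mstP rkP deathP alpha _ H.
have HQ : H \subset edges (Q K ent alpha) by apply: HoPeS_sub.
have [Hspans Hiso] : spans H (Q K ent alpha) /\ H1iso H (Q K ent alpha).
  by apply/(spans_H1isoP HQ); apply: HoPeS_basis; last apply: mst_alive_lightly_spanning.
split=> // G Gspans Giso; apply: HoPeS_min_len => //.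
by apply/spans_H1isoP; [case: Gspans | split].
Qed.
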